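(* Suppose $K$ is a compact Hausdorff space. Then $C(K)$ has a closed infinite dimensional subspace which does stable phase retrieval in $C(K)$ if and only if $K'$ is infinite.
   Context: $C(K)$ is the Banach lattice of real-valued continuous functions on $K$ with the supremum norm and pointwise order. $K'$ denotes the Cantor-Bendixson derivative of $K$, i.e. the set of all non-isolated points of $K$. A subspace $E$ of a real Banach lattice $X$ does stable phase retrieval (SPR) if there is a constant $C$ such that $\min_{\lambda\in\{1,-1\}}\|f-\lambda g\|\leq C\big\||f|-|g|\big\|$ for all $f,g\in E$. *)

(* Defs.v *)
From HB Require Import structures.
From mathcomp Require Import all_boot all_order all_algebra.
From mathcomp Require Import all_classical all_reals all_analysis.

Set Implicit Arguments.
Unset Strict Implicit.
Unset Printing Implicit Defensive.

Import Order.TTheory GRing.Theory Num.Theory.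
Import numFieldNormedType.Exports.

Local Open Scope classical_set_scope.
Local Open Scope ring_scope.

(* C(K). Compactness of K is carried by the type: it is what makes the supremum
   norm finite, hence lets the instances below be canonical. *)
Definition cfun (R : realType) (K : topologicalType) (cK : compact [set: K]) :
  Type := continuousType K R.

Section cfun_space.
Context (R : realType) (K : topologicalType) (cK : compact [set: K]).
Local Notation CK := (@cfun R K cK).
Implicit Types (f g h : CK) (a b : R).

HB.instance Definition _ := Choice.copy CK (continuousType K R).

Definition cfun_fun f : K -> R := Continuous.sort f.
Local Coercion cfun_fun : cfun >-> Funclass.

Lemma cfunP f g : f =1 g -> f = g.
Proof. by move=> fg; apply/continuousEP. Qed.

Lemma cfun_continuous f : continuous (cfun_fun f).
Proof. exact: cts_fun. Qed.

Definition cfun_mk (u : K -> R) (cu : continuous u) : CK :=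
  (mkcts cu : continuousType K R).

Lemma cfun_mkE u (cu : continuous u) x : cfun_mk cu x = u x.
Proof. by []. Qed.

Let zero_cts : continuous (fun _ : K => 0 : R).
Proof. exact: cst_continuous. Qed.

Let opp_cts f : continuous (fun x => - f x).
Proof. by move=> x; apply: cvgN; exact: cfun_continuous. Qed.

Let add_cts f g : continuous (fun x => f x + g x).
Proof. by move=> x; apply: cvgD; exact: cfun_continuous. Qed.

Let scale_cts a f : continuous (fun x => a * f x).
Proof. by move=> x; apply: cvgMr; exact: cfun_continuous. Qed.

Let abs_cts f : continuous (fun x => `|f x|).
Proof. by move=> x; apply: cvg_norm; exact: cfun_continuous. Qed.

Definition cfun_zero : CK := cfun_mk zero_cts.
Definition cfun_opp f : CK := cfun_mk (opp_cts (f := f)).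
Definition cfun_add f g : CK := cfun_mk (add_cts (f := f) (g := g)).
Definition cfun_scale a f : CK := cfun_mk (scale_cts (a := a) (f := f)).

(* The modulus |f| = f \/ (-f) of the Banach lattice C(K); for the pointwise
   order it is the pointwise absolute value. *)
Definition cfun_abs f : CK := cfun_mk (abs_cts (f := f)).

Let addA : associative cfun_add.
Proof. by move=> f g h; apply/cfunP => x; exact: addrA. Qed.
Let addC : commutative cfun_add.
Proof. by move=> f g; apply/cfunP => x; exact: addrC. Qed.
Let add0 : left_id cfun_zero cfun_add.
Proof. by move=> f; apply/cfunP => x; exact: add0r. Qed.
Let addN : left_inverse cfun_zero cfun_opp cfun_add.
Proof. by move=> f; apply/cfunP => x; exact: addNr. Qed.

HB.instance Definition _ := GRing.isZmodule.Build CK addA addC add0 addN.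

Let scaleA a b f : cfun_scale a (cfun_scale b f) = cfun_scale (a * b) f.
Proof. by apply/cfunP => x; exact: mulrA. Qed.
Let scale1 : left_id 1 cfun_scale.
Proof. by move=> f; apply/cfunP => x; exact: mul1r. Qed.
Let scaleDr : right_distributive cfun_scale +%R.
Proof. by move=> a f g; apply/cfunP => x; exact: mulrDr. Qed.
Let scaleDl f : {morph cfun_scale^~ f : a b / a + b}.
Proof. by move=> a b; apply/cfunP => x; exact: mulrDl. Qed.

HB.instance Definition _ :=
  GRing.Zmodule_isLmodule.Build R CK scaleA scale1 scaleDr scaleDl.

(* The supremum of the empty set is 0, so C(K) = {0} has norm 0 if K is empty. *)
Definition cfun_norm f : R := sup [set `|f x| | x in [set: K]].

Lemma cfun_norm_ub f x : `|f x| <= cfun_norm f.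
Proof.
apply: ub_le_sup; last by exists x.
have : compact [set `|f y| | y in [set: K]].
  apply: continuous_compact => //; apply: continuous_subspaceT.
  exact: abs_cts.
move=> /compact_bounded [M [_ HM]]; exists (M + 1) => _ [y _ <-].
by rewrite -normr_id; apply: (HM (M + 1)); [rewrite ltrDl|exists y].
Qed.

Lemma cfun_norm_le f a : 0 <= a -> (forall x, `|f x| <= a) -> cfun_norm f <= a.
Proof.
move=> a0 fa; rewrite /cfun_norm; have [->|ne] := eqVneq [set `|f x| | x in [set: K]] set0.
  by rewrite sup0.
by apply: ge_sup; [exact/set0P|move=> _ [x _ <-]].
Qed.

Lemma cfun_norm_ge0 f : 0 <= cfun_norm f.
Proof.
have [fE0|/set0P[_ [x _ _]]] := eqVneq [set `|f x| | x in [set: K]] set0.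
  by rewrite /cfun_norm fE0 sup0.
exact: le_trans (cfun_norm_ub f x).
Qed.

Let normD f g : cfun_norm (f + g) <= cfun_norm f + cfun_norm g.
Proof.
apply: cfun_norm_le => [|x]; first by rewrite addr_ge0 ?cfun_norm_ge0.
by rewrite (le_trans (ler_normD _ _))// lerD ?cfun_norm_ub.
Qed.

Let normZ_le a f : cfun_norm (a *: f) <= `|a| * cfun_norm f.
Proof.
apply: cfun_norm_le => [|x]; first by rewrite mulr_ge0 ?cfun_norm_ge0.
by rewrite [X in X <= _]normrM ler_wpM2l ?cfun_norm_ub.
Qed.

Let normZ a f : cfun_norm (a *: f) = `|a| * cfun_norm f.
Proof.
apply/eqP; rewrite eq_le normZ_le/=; have [->|a0] := eqVneq a 0.
  by rewrite normr0 mul0r cfun_norm_ge0.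
rewrite -ler_pdivlMl ?normr_gt0// -normfV.
by rewrite (le_trans _ (normZ_le _ _))// scalerA mulVf// scale1r.
Qed.

Let norm0 f : cfun_norm f = 0 -> f = 0.
Proof.
move=> f0; apply/cfunP => x; apply/eqP; rewrite -normr_le0 -f0.
exact: cfun_norm_ub.
Qed.

HB.instance Definition _ := Lmodule_isNormed.Build R CK normD normZ norm0.

Lemma cfun_normE f : `|f| = sup [set `|f x| | x in [set: K]].
Proof. by []. Qed.

End cfun_space.

Coercion cfun_fun : cfun >-> Funclass.

Section subspaces.
Context (R : realType) (V : lmodType R).

Definition linear_subspace (E : set V) : Prop := submod_closed (mem E).

Definition finite_dimensional (E : set V) : Prop :=
  exists (n : nat) (b : 'I_n -> V), (forall i, E (b i)) /\
    forall v, E v -> exists c : 'I_n -> R, v = \sum_(i < n) c i *: b i.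

End subspaces.

Definition stable_phase_retrieval (R : realType) (K : topologicalType)
    (cK : compact [set: K]) (E : set (cfun R cK)) : Prop :=
  exists C : R, forall f g, E f -> E g ->
    Num.min `|f - g| `|f + g| <= C * `|cfun_abs f - cfun_abs g|.

Definition cantor_bendixson_derivative (K : topologicalType) : set K :=
  ~` isolated [set: K].

Arguments cantor_bendixson_derivative K : clear implicits.

(* Main.v *)
Require Import Defs.
From mathcomp Require Import all_boot all_order all_algebra.
From mathcomp Require Import all_classical all_reals all_analysis.
From mathcomp Require Import lra zify.
Import Order.TTheory GRing.Theory Num.Theory.
Import numFieldNormedType.Exports.
Local Open Scope classical_set_scope.
Local Open Scope ring_scope.

(** For real numbers, [| |a| - |b| |] is the smaller of [|a - b|] and
    [|a + b|]. Substituting [u = f - g] and [v = f + g], stable phase retrieval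
    on a subspace says that the norm of the pointwise minimum [|u| /\ |v|]
    controls the smaller of the norms of [u] and [v] ([spr_min]): the subspace
    has no almost disjoint pair of unit vectors.

    Suppose that [K'] is finite. Finitely many point evaluations never separate
    the vectors of an infinite dimensional subspace [E], so some unit vector [u]
    of [E] vanishes on [K']. The compact set where [|u| >= eps] then consists of
    isolated points, so it is finite, and some unit vector [v] of [E] vanishes
    on it. Everywhere [|u| /\ |v| <= eps], which contradicts the criterion.

    Suppose that [K'] is infinite. Then there are disjoint open sets
    [V 0, V 1, ...], each containing a point of [K']. On [V n] build a plateau
    function equal to [1] at infinitely many points, and infinitely many smaller
    bumps of height [1/8] with disjoint supports, each peaking at one of those
    points; every neighbourhood of a non-isolated point has room for them. Let
    [e j] be the plateau of [V j] plus one small bump in each of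
    [V 0, ..., V (j - 1)].
    For every pair [n < m] there is then a point [w n m] where [e n] is [1],
    [e m] is [1/8] and all others vanish, and a point [z n] where only [e n] is
    nonzero and equals [1]. Only finitely many bumps go into each [e j], which
    keeps it continuous; this suffices because the two vectors to be compared
    play symmetric roles, so one may assume [n < m].

    At each point at most two of the [e j] are nonzero, so a function of the
    form [f = sum_j a j e j] has [a j = f (z j)], and its norm is at most
    [2 sup |a j|]. The functions that satisfy this expansion pointwise form the
    required subspace. If [u] is large at [z n] and [v] is large at [z m], with
    [n < m], then either [v] is not too small at [z n], or
    [v (w n m) = v (z n) + v (z m) / 8] is not small while
    [u (w n m) = u (z n) + u (z m) / 8] is still large; in both cases
    [|u| /\ |v|] is bounded below by a fixed multiple of the smaller norm
    ([common_large_point]). *)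

(** * Stable phase retrieval and almost disjoint pairs *)

Lemma abs_sub_abs (R : realDomainType) (a b : R) :
  `| `|a| - `|b| | = Num.min `|a - b| `|a + b|.
Proof.
rewrite minEle; case: (ger0P a) => ?; case: (ger0P b) => ?;
  case: (ger0P (a - b)) => ?; case: (ger0P (a + b)) => ?;
  case: ifP => /idP ?; try lra;
  match goal with |- `|?t| = _ => case: (ger0P t) => ?; lra end.
Qed.

Lemma linear_subspace_comb (R : realType) (V : lmodType R) (E : set V) a b u v :
  linear_subspace E -> E u -> E v -> E (a *: u + b *: v).
Proof.
move=> [E0 EZ] /mem_set Eu /mem_set Ev.
have /(EZ b v 0 Ev) := E0; rewrite addr0 => Ebv.
by have := EZ a _ _ Eu Ebv; rewrite !inE.
Qed.

(** The norm of [|u| /\ |v|] enters only through its upper bounds [m], which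
    avoids building that function. *)
Lemma spr_min (R : realType) (K : topologicalType) (cK : compact [set: K])
    (E : set (cfun R cK)) : linear_subspace E ->
  stable_phase_retrieval E <->
  exists2 C : R, 0 <= C & forall u v m, E u -> E v -> 0 <= m ->
    (forall x, Num.min `|u x| `|v x| <= m) -> Num.min `|u| `|v| <= C * m.
Proof.
move=> lE; split => [[C HC]|[C C0 HC]].
  exists `|C| => // u v m Eu Ev m0 uvm.
  pose f : cfun R cK := 2^-1 *: u + 2^-1 *: v.
  pose g : cfun R cK := - 2^-1 *: u + 2^-1 *: v.
  have fgu : f - g = u.
    apply/cfunP => x; change ((2^-1 * u x + 2^-1 * v x) -
      (- 2^-1 * u x + 2^-1 * v x) = u x); lra.
  have fgv : f + g = v.
    apply/cfunP => x; change ((2^-1 * u x + 2^-1 * v x) +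
      (- 2^-1 * u x + 2^-1 * v x) = v x); lra.
  have := HC f g (linear_subspace_comb _ _ _ _ _ _ _ lE Eu Ev)
             (linear_subspace_comb _ _ _ _ _ _ _ lE Eu Ev).
  rewrite fgu fgv => /le_trans; apply.
  rewrite (le_trans (ler_wpM2r _ (ler_norm C)))// ler_wpM2l//.
  apply: cfun_norm_le => // x.
  change (`| `|f x| - `|g x| | <= m); rewrite abs_sub_abs.
  change (Num.min `|(f - g) x| `|(f + g) x| <= m).
  rewrite fgu fgv; exact: uvm.
exists C => f g Ef Eg; apply: HC => //.
- have := linear_subspace_comb _ _ _ 1 (-1) _ _ lE Ef Eg.
  by rewrite scaleN1r scale1r.
- by have := linear_subspace_comb _ _ _ 1 1 _ _ lE Ef Eg; rewrite !scale1r.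
- move=> x; change (Num.min `|f x - g x| `|f x + g x| <= `|cfun_abs f - cfun_abs g|).
  by rewrite -abs_sub_abs; exact: (cfun_norm_ub (cfun_abs f - cfun_abs g)).
Qed.

(** * Finite derivative: almost disjoint unit vectors exist *)

(** If [phi] does not vanish on [E], a basis of the kernel together with one
    vector outside the kernel would span [E]. *)
Lemma infinite_dim_kernel (R : realType) (V : lmodType R) (E : set V)
    (phi : V -> R) : scalar phi ->
  linear_subspace E -> ~ finite_dimensional E ->
  linear_subspace (E `&` [set v | phi v = 0]) /\
  ~ finite_dimensional (E `&` [set v | phi v = 0]).
Proof.
move=> lphi lE infE.
have phi0 : phi 0 = 0.
  have := lphi 1 0 0; rewrite scaler0 addr0 mul1r => /eqP.
  by rewrite -subr_eq0 opprD addNKr oppr_eq0 => /eqP.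
have phiZ a v : phi (a *: v) = a * phi v.
  by have := lphi a v 0; rewrite !addr0 phi0 addr0.
split.
  split; first by rewrite inE; split => //; have [] := lE; rewrite inE.
  move=> a u v; rewrite !inE => -[Eu /= u0] [Ev /= v0]; split.
    by have := linear_subspace_comb _ _ _ a 1 _ _ lE Eu Ev; rewrite scale1r.
  by rewrite /= lphi u0 v0 mulr0 addr0.
move=> [n [b [Eb bE]]]; apply: infE.
have [[e [Ee phie]]|nphi] := pselect (exists e, E e /\ phi e != 0); last first.
  exists n, b; split => [i|v Ev]; first by case: (Eb i).
  apply: bE; split => //=; apply/eqP/negP => /negP vN0; apply: nphi.
  by exists v.
exists n.+1, (fun i => if unlift ord0 i is Some j then b j else e); split.
  by move=> i; case: unliftP => [j _|_] //; case: (Eb j).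
move=> v Ev; have [|c Hc] := bE (v - (phi v / phi e) *: e).
  split.
    have := linear_subspace_comb _ _ _ 1 (- (phi v / phi e)) _ _ lE Ev Ee.
    by rewrite scale1r scaleNr.
  by rewrite /= addrC -scaleNr lphi mulNr divfK// addNr.
exists (fun i => if unlift ord0 i is Some j then c j else phi v / phi e).
rewrite big_ord_recl unlift_none; under eq_bigr do rewrite liftK.
by rewrite -Hc addrC subrK.
Qed.

(** Each point of [F] costs at most one dimension. *)
Lemma vanishing_unit_vector (R : realType) (K : topologicalType)
    (cK : compact [set: K]) (E : set (cfun R cK)) (F : set K) :
  linear_subspace E -> ~ finite_dimensional E -> finite_set F ->
  exists f, [/\ E f, `|f| = 1 & forall x, F x -> f x = 0].
Proof.
move=> + + /finite_seqP[s ->]; elim: s E => [|x s IH] E lE infE.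
  have [f Ef f0] : exists2 f, E f & f != 0.
    apply/not_exists2P => E0; apply: infE; exists 0%N, (fun=> 0); split => [[]//|v Ev].
    exists (fun=> 0); rewrite big_ord0; apply/eqP/negP => /negP v0.
    by have [] := E0 v.
  exists (`|f|^-1 *: f); split => //.
    have := linear_subspace_comb _ _ _ `|f|^-1 0 _ _ lE Ef Ef.
    by rewrite scale0r addr0.
  by rewrite normrZ normfV normr_id mulVf// normr_eq0.
have [|lE' infE'] := infinite_dim_kernel _ _ _ (fun f : cfun R cK => f x) _
  lE infE; first by [].
have [f [[Ef fx] f1 fs]] := IH _ lE' infE'.
exists f; split => // y /=; rewrite inE => /orP[/eqP->//|]; exact: fs.
Qed.

Lemma isolatedTP (K : topologicalType) (x : K) :
  isolated [set: K] x <-> nbhs x [set x].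
Proof.
split => [[_ [V Vx]]|xx]; first by rewrite setIT => <-.
by split; [rewrite inE|exists [set x]; rewrite ?setIT].
Qed.

(** If [A] were infinite, the complements in [A] of the finite sets would form
    a filter, and a cluster point of it in [A] could not be isolated. *)
Lemma finite_compact_isolated (K : topologicalType) (A : set K) :
  compact A -> A `<=` isolated [set: K] -> finite_set A.
Proof.
move=> cA Aiso; apply: contrapT => infA.
pose F := filter_from [set B : set K | finite_set B] (fun B => A `\` B).
have FF : ProperFilter F.
  apply: filter_from_proper.
    apply: filter_from_filter; first by exists set0; exact: finite_set0.
    move=> B C fB fC; exists (B `|` C); first by rewrite /= finite_setU.
    by move=> x [Ax /not_orP[]].
  move=> B fB; apply: infinite_setN0 => fAB; apply: infA.
  apply: (@sub_finite_set _ _ ((A `\` B) `|` B)); last by rewrite finite_setU.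
  by move=> x Ax; have [|] := pselect (B x); [right|left].
have [|x [Ax clx]] := cA F FF.
  by exists set0; [exact: finite_set0|move=> x []].
have [//||y [[_ yx] /= yx']] := clx (A `\` [set x]) [set x].
- by exists [set x] => //; exact: finite_set1.
- by apply/isolatedTP; exact: Aiso.
- exact: yx.
Qed.

Lemma finite_superlevel (R : realType) (K : topologicalType)
    (cK : compact [set: K]) (f : cfun R cK) (e : R) : 0 < e ->
  (forall x, cantor_bendixson_derivative K x -> f x = 0) ->
  finite_set [set x | e <= `|f x|].
Proof.
move=> e0 f0; apply: finite_compact_isolated.
  apply: (subclosed_compact _ cK) => //.
  apply: (@preimage_closed _ _ (fun x => `|f x|) [set r | e <= r]).
    by move=> x _; apply: cvg_norm; exact: cfun_continuous.
  exact: closed_ge.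
move=> x /= efx; apply: contrapT => /f0 fx.
by move: efx; rewrite fx normr0 leNgt e0.
Qed.

Lemma finite_derivative_no_spr (R : realType) (K : topologicalType)
    (cK : compact [set: K]) (E : set (cfun R cK)) :
  finite_set (cantor_bendixson_derivative K) ->
  linear_subspace E -> ~ finite_dimensional E -> ~ stable_phase_retrieval E.
Proof.
move=> finK lE infE /(spr_min _ _ _ _ lE)[C C0 HC].
(* This makes C * e < 1. *)
pose e := (C + 1)^-1 / 2.
have e0 : 0 < e by rewrite divr_gt0// invr_gt0 ltr_wpDl.
have [u [Eu u1 u0]] := vanishing_unit_vector _ _ _ _ _ lE infE finK.
have finL := finite_superlevel _ _ _ _ _ e0 u0.
have [v [Ev v1 v0]] := vanishing_unit_vector _ _ _ _ _ lE infE finL.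
have := HC u v e Eu Ev (ltW e0); rewrite u1 v1 minxx => /(_ _)/wrap[x|].
  rewrite ge_min; have [/v0->|/ltW->//] := lerP e `|u x|.
  by rewrite normr0 (ltW e0) orbT.
apply/negP; rewrite -ltNge /e mulrA -ltr_pdivlMr// div1r invrK.
by rewrite ltr_pdivrMr ?ltr_wpDl//; lra.
Qed.

(** * Disjoint open sets and bump functions *)

Lemma bump_function (R : realType) (K : topologicalType) (x : K) (U : set K) :
  compact [set: K] -> hausdorff_space K -> open U -> U x ->
  exists h : K -> R, [/\ continuous h, forall y, 0 <= h y <= 1, h x = 1 &
    forall y, ~ U y -> h y = 0].
Proof.
move=> cK hK oU Ux.
have sep : uniform_separator [set x] (~` U).
  apply: (@normal_completely_regular R) => //; first exact: compact_normal.
  - exact: hausdorff_accessible.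
  - exact: open_closedC.
have /(@uniform_separatorP _ R)[f [cf f01 f0 f1]] := sep.
exists (fun y => 1 - f y); split.
- by move=> y; apply: cvgB; [exact: cvg_cst|exact: cf].
- move=> y; have /= := f01 (f y) (imageT _ _); rewrite in_itv/= => /andP[? ?].
  by apply/andP; split; lra.
- by have /= -> := f0 (f x) (imageP _ erefl); rewrite subr0.
- move=> y Uy; have /= -> := f1 (f y) (imageP f (A := ~` U) Uy).
  by rewrite subrr.
Qed.

Lemma open_sublevel (R : realType) (K : topologicalType) (h : K -> R) a :
  continuous h -> open [set x | h x < a].
Proof.
by move=> ch; apply: (@open_comp _ _ h [set r | r < a]) => // *; exact: open_lt.
Qed.

Lemma open_strict_superlevel (R : realType) (K : topologicalType) (h : K -> R) a :
  continuous h -> open [set x | a < h x].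
Proof.
by move=> ch; apply: (@open_comp _ _ h [set r | a < r]) => // *; exact: open_gt.
Qed.

(** The inductive step of the next lemma. Take a function [h] with values [0]
    and [1] at two points of [O `&` S]. One of the regions [h < 1/2] and
    [h >= 1/2] meets [O `&` S] in an infinite set; keep (an open set containing)
    it as [O'], and take for [V] an open set around the other point. *)
Lemma split_off_open (R : realType) (K : topologicalType) (S O : set K) :
  compact [set: K] -> hausdorff_space K -> open O -> infinite_set (O `&` S) ->
  exists V O' : set K, [/\ open V, open O', V `&` S !=set0, V `<=` O &
    [/\ O' `<=` O, V `&` O' = set0 & infinite_set (O' `&` S)]].
Proof.
move=> cK hK oO infOS.
have [a [Oa Sa]] := infinite_setN0 infOS.
have [b [[Ob Sb] /= ba]] : (O `&` S) `\` [set a] !=set0.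
  apply: infinite_setN0 => fin; apply: infOS.
  apply: (@sub_finite_set _ _ (((O `&` S) `\` [set a]) `|` [set a])).
    by move=> x OSx; have [|] := pselect (x = a); [right|left].
  by rewrite finite_setU; split => //; exact: finite_set1.
have oa : open (~` [set a]).
  by apply: closed_openC; apply: accessible_closed_set1; exact: hausdorff_accessible.
have [h [ch h01 hb ha]] := bump_function R K b _ cK hK oa ba.
have {}ha : h a = 0 by apply: ha => /=; apply.
have [fin|inf] := pselect (finite_set (O `&` [set x | h x < 2^-1] `&` S)).
  (* The levels 1/4 and 1/2 differ so that O' contains the closed region. *)
  exists (O `&` [set x | h x < 4^-1]), (O `&` [set x | 4^-1 < h x]); split.
  - by apply: openI => //; exact: open_sublevel.
  - by apply: openI => //; exact: open_strict_superlevel.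
  - by exists a; split => //; split => //=; rewrite ha; lra.
  - exact: subIsetl.
  - split; first exact: subIsetl.
      by apply/seteqP; split => // x [[_ /= h1] [_ /= /(lt_trans h1)]]; rewrite ltxx.
    move=> fin'; apply: infOS.
    apply: sub_finite_set (_ : finite_set (_ `|` _)); last first.
      by rewrite finite_setU; split; [exact: fin|exact: fin'].
    move=> x [Ox Sx]; have [?|?] := ltP (h x) 2^-1; [left|right]; do !split => //=.
    by lra.
exists (O `&` [set x | 2^-1 < h x]), (O `&` [set x | h x < 2^-1]); split.
- by apply: openI => //; exact: open_strict_superlevel.
- by apply: openI => //; exact: open_sublevel.
- by exists b; split => //; split => //=; rewrite hb; lra.
- exact: subIsetl.
- split; [exact: subIsetl| |exact: inf].
  by apply/seteqP; split => // x [[_ /= h1] [_ /= /(lt_trans h1)]]; rewrite ltxx.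
Qed.

Lemma disjoint_open_sequence (R : realType) (K : topologicalType) (S : set K) :
  compact [set: K] -> hausdorff_space K -> infinite_set S ->
  exists (V : nat -> set K) (x : nat -> K),
    [/\ forall n, open (V n), forall n, V n (x n), forall n, S (x n) &
      forall n m y, V n y -> V m y -> n = m].
Proof.
move=> cK hK infS.
pose X := {O : set K | open O /\ infinite_set (O `&` S)}.
pose next (O O' : X) := exists V : set K, [/\ open V, V `&` S !=set0,
  V `<=` sval O, sval O' `<=` sval O & V `&` sval O' = set0].
have XT : open [set: K] /\ infinite_set ([set: K] `&` S).
  by split; [exact: openT|rewrite setTI].
have [G [_ HG]] : {O : nat -> X | O 0%N = exist _ _ XT /\
    forall n, next (O n) (O n.+1)}.
  apply: dependent_choice => -[Q [oQ infQ]]; apply: cid.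
  have [V [Q' [oV oQ' VS VO [Q'Q VQ' infQ']]]] := split_off_open R K S Q cK hK oQ infQ.
  by exists (exist _ Q' (conj oQ' infQ')), V; split.
have /choice [V HV] := HG.
have /choice [x Hx] : forall n, exists y, V n y /\ S y.
  by move=> n; have [_ [y ?] _ _ _] := HV n; exists y.
have OO m n : (m <= n)%N -> sval (G n) `<=` sval (G m).
  elim: n => [|n IH]; first by rewrite leqn0 => /eqP->.
  rewrite leq_eqVlt => /orP[/eqP->//|/IH]; apply: subset_trans.
  by have [_ _ _ ? _] := HV n.
have lt_disj m n y : (m < n)%N -> V m y -> ~ V n y.
  move=> mn Vm Vn; have [_ _ _ _ V0] := HV m.
  suff : (V m `&` sval (G m.+1)) y by rewrite V0.
  split => //; apply: (OO _ _ mn); have [_ _ + _ _] := HV n; exact.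
exists V, x; split => [n|n|n|n m y Vn Vm]; [by case: (HV n)|by case: (Hx n)..|].
by case: (ltngtP n m) => // [/lt_disj/(_ Vn)|/lt_disj/(_ Vm)].
Qed.

Lemma non_isolated_infinite (K : topologicalType) (x : K) (W : set K) :
  hausdorff_space K -> ~ isolated [set: K] x -> open W -> W x -> infinite_set W.
Proof.
move=> hK nx oW Wx fW; apply/nx/isolatedTP.
have : closed (W `\ x).
  apply: (accessible_finite_set_closed.1 (hausdorff_accessible hK)).
  exact: finite_setD.
move=> /closed_openC oC.
apply: (filterS (P := W `&` ~` (W `\ x))).
  by move=> y [Wy /not_andP[//|/contrapT]].
by apply: open_nbhs_nbhs; split; [exact: openI|split => // -[_]; apply].
Qed.

(** A cut-off [t 0] that equals [1] on a neighbourhood of [p] leaves room for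
    infinitely many disjoint small bumps [t k.+1] inside its plateau, because
    that neighbourhood is infinite. No bump peaks at the point [y 0], where the
    plateau is seen alone. *)
Lemma plateau_and_bumps (R : realType) (K : topologicalType) (V : set K) (p : K) :
  compact [set: K] -> hausdorff_space K ->
  open V -> V p -> ~ isolated [set: K] p ->
  exists (t : nat -> K -> R) (y : nat -> K),
   [/\ forall k, continuous (t k), forall k x, 0 <= t k x <= 1,
       forall k x, ~ V x -> t k x = 0,
       forall i, t 0%N (y i) = 1 &
       (forall k i, t k.+1 (y i) = (i == k.+1)%:R / 8) /\
       forall x, exists k, forall j, j != k -> t j.+1 x = 0].
Proof.
move=> cK hK oV Vp np.
have [h [ch h01 hp hV]] := bump_function R K p V cK hK oV Vp.
pose W := [set x | 2^-1 < h x].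
have oW : open W by exact: open_strict_superlevel.
have Wp : W p by rewrite /W /= hp; lra.
have WV x : W x -> V x.
  by move=> Wx; apply: contrapT => /hV hx; move: Wx; rewrite /W /= hx; lra.
have [U [y [oU Uy Wy Udisj]]] := disjoint_open_sequence R K W cK hK
  (non_isolated_infinite K p W hK np oW Wp).
have /choice [g Hg] : forall k, exists g : K -> R, [/\ continuous g,
    forall x, 0 <= g x <= 1, g (y k) = 1 & forall x, ~ (U k `&` W) x -> g x = 0].
  move=> k; apply: (bump_function R K (y k) (U k `&` W) cK hK (openI (oU k) oW)).
  exact: conj (Uy k) (Wy k).
have g_eq1 k i : g k (y i) = (i == k)%:R.
  have [_ _ gk g0] := Hg k; have [->//|ik] := eqVneq i k.
  by apply: g0 => -[Uk _]; move/eqP: ik; apply; exact: Udisj (Uy i) Uk.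
exists (fun k x => if k is j.+1 then g j.+1 x / 8 else Num.min 1 (2 * h x)), y.
split => [[|k]|[|k] x|[|k] x Vx|i|].
- move=> x; apply: (@continuous_min R K (fun=> 1) (fun x => 2 * h x)).
    exact: cst_continuous.
  by apply: cvgMr; exact: ch.
- by move=> x; apply: cvgMl; have [+ _ _ _] := Hg k.+1; exact.
- rewrite le_min ler01 ge_min lexx /= andbT.
  by case/andP: (h01 x) => ? _; lra.
- by have [_ /(_ x)/andP[? ?] _ _] := Hg k.+1; apply/andP; split; lra.
- by rewrite hV// mulr0; apply/min_idPr.
- by have [_ _ _ ->] := Hg k.+1; rewrite ?mul0r// => -[_ /WV].
- by apply/min_idPl; have := Wy i; rewrite /W /= => ?; lra.
split => [k i|x]; first by rewrite g_eq1.
have [[k Uk]|nU] := pselect (exists k, U k.+1 x).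
  exists k => j /eqP jk; have [_ _ _ ->] := Hg j.+1; rewrite ?mul0r// => -[Uj _].
  by apply: jk; have [] := Udisj _ _ _ Uj Uk.
exists 0%N => j _; have [_ _ _ ->] := Hg j.+1; rewrite ?mul0r// => -[Uj _].
by apply: nU; exists j.
Qed.

(** The pattern of values behind the construction. In [V n] put the plateau of
    [e n] and, for each [j > n], one small bump of [e j]. A point of [V n]
    therefore sees [e n] and at most one other [e j]; [p x] and [q x] name two
    indices outside of which all [e j] vanish at [x]. *)
Lemma biorthogonal_bumps (R : realType) (K : topologicalType) :
  compact [set: K] -> hausdorff_space K ->
  infinite_set (cantor_bendixson_derivative K) ->
  exists (e : nat -> K -> R) (z : nat -> K) (w : nat -> nat -> K) (p q : K -> nat),
   [/\ forall j, continuous (e j), forall j x, 0 <= e j x <= 1,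
       forall n j, e j (z n) = (j == n)%:R,
       forall n m j, (n < m)%N -> e j (w n m) = (j == n)%:R + (j == m)%:R / 8 &
       forall x, p x != q x /\ forall j, j != p x -> j != q x -> e j x = 0].
Proof.
move=> cK hK infK.
have [V [c [oV Vc Kc Vdisj]]] := disjoint_open_sequence R K _ cK hK infK.
have /choice [t /choice[y Hty]] :=
  fun n => plateau_and_bumps R K _ _ cK hK (oV n) (Vc n) (Kc n).
pose e j x := \sum_(n < j.+1) t n (j - n)%N x.
have eE n x j : V n x -> e j x = if (n <= j)%N then t n (j - n)%N x else 0.
  move=> Vx; have t0 m : m != n -> t m (j - m)%N x = 0.
    have [_ _ tm0 _ _] := Hty m => /eqP mn; apply: tm0 => Vm.
    by apply: mn; exact: Vdisj Vm Vx.
  case: leqP => nj; last first.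
    rewrite /e big1// => i _; apply: t0; apply/eqP => im.
    by have := ltn_ord i; rewrite im ltnS leqNgt nj.
  rewrite /e (bigD1 (Ordinal (nj : (n < j.+1)%N)))//= big1 ?addr0// => i.
  by move=> /eqP ni; apply: t0; apply/eqP => im; apply: ni; exact/val_inj.
have yV n i : V n (y n i).
  have [_ _ t0 t1 _] := Hty n; apply: contrapT => /(t0 0%N).
  by rewrite t1 => /eqP; rewrite oner_eq0.
have e0 j x : (forall n, ~ V n x) -> e j x = 0.
  move=> nV; rewrite /e big1// => i _.
  by have [_ _ t0 _ _] := Hty i; exact: t0 (nV i).
have /choice [p /choice[q Hpq]] : forall x, exists p q, p != q /\
    forall j, j != p -> j != q -> e j x = 0.
  move=> x; have [[n Vx]|nV] := pselect (exists n, V n x); last first.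
    exists 0%N, 1%N; split => // j _ _; apply: e0 => n Vx.
    by apply: nV; exists n.
  have [_ _ _ _ [_ /(_ x)[k tk]]] := Hty n.
  exists n, (n + k.+1)%N; split=> [|j jn jk]; first by lia.
  rewrite (eE n)//; case: leqP => // nj.
  have -> : (j - n = (j - n).-1.+1)%N by lia.
  by apply: tk; lia.
exists e, (y^~ 0%N), (fun n m => y n (m - n)%N), p, q; split => //.
- move=> j; rewrite /e; apply: continuous_big => [|n _]; first exact: add_continuous.
  by have [+ _ _ _ _] := Hty n; exact.
- move=> j x; have [[n Vx]|nV] := pselect (exists n, V n x); last first.
    by rewrite e0 ?lexx ?ler01// => n Vx; apply: nV; exists n.
  rewrite (eE n)//; case: leqP; rewrite ?lexx ?ler01//.
  by have [_ + _ _ _] := Hty n.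
- move=> n j; rewrite (eE n)//; have [_ _ _ t1 [t2 _]] := Hty n.
  case: ltngtP => [nj|//|->]; last by rewrite subnn; have [_ _ _ -> _] := Hty j.
  have -> : (j - n = (j - n).-1.+1)%N by lia.
  by rewrite t2 mul0r.
- move=> n m j nm; rewrite (eE n)//; have [_ _ _ t1 [t2 _]] := Hty n.
  case: (ltngtP n j) => [nj|jn|<-].
  + have -> : (j - n = (j - n).-1.+1)%N by lia.
    rewrite t2 add0r (_ : (m - n == _)%N = (j == m))//.
    by apply/eqP/eqP; lia.
  + by rewrite add0r ltn_eqF ?mul0r//; lia.
  + by rewrite subnn t1 ltn_eqF// mul0r addr0.
Qed.

(** * The subspace *)

Lemma eval_continuous (R : realType) (K : topologicalType)
  (cK : compact [set: K]) (x : K) : continuous (fun f : cfun R cK => f x).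
Proof.
move=> f; have FF : Filter (nbhs f) by exact: nbhs_filter.
apply/(@cvgrPdist_lt _ _ _ (nbhs f) FF) => e e0.
apply/nbhs_ballP; exists e => // g /=.
rewrite -ball_normE /= => fge.
exact: le_lt_trans (cfun_norm_ub (f - g) x) fge.
Qed.

(** A finite spanning family would factor an identity matrix of size [n + 1],
    the values [e j (z m)], through dimension [n]. *)
Lemma dual_system_infinite_dim (R : realType) (K : topologicalType)
    (cK : compact [set: K]) (E : set (cfun R cK)) (z : nat -> K)
    (e : nat -> cfun R cK) :
  (forall n, E (e n)) -> (forall n j, e j (z n) = (j == n)%:R) ->
  ~ finite_dimensional E.
Proof.
move=> Ee ez [n [b [Eb bE]]].
have /choice [c Hc] := fun j : 'I_n.+1 => bE _ (Ee j).
have sumE (I : finType) (F : I -> cfun R cK) x : (\sum_i F i) x = \sum_i (F i x).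
  by elim/big_ind2 : _ => // f a g a' <- <-.
have cb1 : (\matrix_(j < n.+1, i < n) c j i) *m
    (\matrix_(i < n, m < n.+1) b i (z m)) = 1%:M.
  apply/matrixP => j m; rewrite !mxE.
  transitivity (e j (z m)); last by rewrite ez.
  rewrite [e j]Hc; apply: eq_trans (esym (sumE _ _ _)).
  by apply: eq_bigr => i _; rewrite !mxE.
have := mulmx_max_rank (\matrix_(j < n.+1, i < n) c j i)
    (\matrix_(i < n, m < n.+1) b i (z m)).
by rewrite cb1 mxrank1 ltnn.
Qed.

Section interpolation_space.
Context (R : realType) (K : topologicalType) (cK : compact [set: K]).
Context (e : nat -> K -> R) (z : nat -> K) (w : nat -> nat -> K).
Context (p q : K -> nat).

(** The functions [sum_j f (z j) e j]. As at most two terms are nonzero at each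
    point, the expansion is a family of linear conditions, one at each [x] and
    each involving three values of [f]; so linearity and closedness come
    without discussing convergence of the sum. *)
Definition interpolation_space : set (cfun R cK) :=
  [set f | forall x, f x = f (z (p x)) * e (p x) x + f (z (q x)) * e (q x) x].

Lemma interpolation_space_linear : linear_subspace interpolation_space.
Proof.
split; first by rewrite inE => x; rewrite /cfun_fun /= !mul0r addr0.
have comb a (f g : cfun R cK) : interpolation_space f ->
    interpolation_space g -> interpolation_space (a *: f + g).
  move=> Hf Hg x.
  change (a * f x + g x =
    (a * f (z (p x)) + g (z (p x))) * e (p x) x +
    (a * f (z (q x)) + g (z (q x))) * e (q x) x).
  by rewrite [in LHS]Hf [in LHS]Hg; lra.
by move=> a f g; rewrite !inE; exact: comb.
Qed.

Lemma interpolation_space_closed : closed interpolation_space.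
Proof.
pose d x (f : cfun R cK) :=
  f x - (f (z (p x)) * e (p x) x + f (z (q x)) * e (q x) x).
have -> : interpolation_space = \bigcap_(x in [set: K]) (d x @^-1` [set r | r = 0]).
  apply/seteqP; split => f Hf x; first by move=> _ /=; rewrite /d -Hf subrr.
  by apply/eqP; rewrite -subr_eq0; apply/eqP; exact: Hf.
apply: closed_bigI => x _; apply: preimage_closed; last exact: closed_eq.
have ev y (f : cfun R cK) : (fun g : cfun R cK => g y) @ f --> f y.
  exact: eval_continuous.
move=> f _; have FF : Filter (nbhs f) by exact: nbhs_filter.
apply: (@cvgB _ _ _ (nbhs f) FF); first exact: ev.
by apply: (@cvgD _ _ _ (nbhs f) FF); apply: (@cvgMl _ _ (nbhs f) FF); exact: ev.
Qed.

Context (e_cts : forall j, continuous (e j)) (e01 : forall j x, 0 <= e j x <= 1).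
Context (ez : forall n j, e j (z n) = (j == n)%:R).
Context (ew : forall n m j, (n < m)%N ->
  e j (w n m) = (j == n)%:R + (j == m)%:R / 8).
Context (pq : forall x,
  p x != q x /\ forall j, j != p x -> j != q x -> e j x = 0).

Lemma interpolation_space_infinite_dim : ~ finite_dimensional interpolation_space.
Proof.
apply: (@dual_system_infinite_dim R K cK _ z (fun j => cfun_mk cK (e_cts j))) => // j x.
change (e j x = e j (z (p x)) * e (p x) x + e j (z (q x)) * e (q x) x).
rewrite !ez; have [pqx ej0] := pq x.
have [->|jp] := eqVneq j (p x); first by rewrite (negbTE pqx) mul1r mul0r addr0.
have [->|jq] := eqVneq j (q x); first by rewrite mul1r mul0r add0r.
by rewrite ej0// !mul0r addr0.
Qed.

Lemma interpolation_at_w f n m : interpolation_space f -> (n < m)%N ->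
  f (w n m) = f (z n) + f (z m) / 8.
Proof.
move=> Hf nm; rewrite Hf; have [pqw ew0] := pq (w n m).
have inpq j : e j (w n m) != 0 -> j = p (w n m) \/ j = q (w n m).
  have [->|jp] := eqVneq j (p (w n m)); first by left.
  have [->|jq] := eqVneq j (q (w n m)); first by right.
  by rewrite ew0// eqxx.
have en : e n (w n m) = 1 by rewrite ew// eqxx ltn_eqF// mul0r addr0.
have em : e m (w n m) = 8^-1 by rewrite ew// eqxx gtn_eqF// mul1r add0r.
have /inpq : e n (w n m) != 0 by rewrite en oner_eq0.
have /inpq : e m (w n m) != 0 by rewrite em invr_eq0 pnatr_eq0.
case=> [mE|mE] [nE|nE].
- by move: nm; rewrite (eq_trans nE (esym mE)) ltnn.
- by rewrite -mE -nE en em; lra.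
- by rewrite -mE -nE en em; lra.
- by move: nm; rewrite (eq_trans nE (esym mE)) ltnn.
Qed.

(** At each point [f] is a sum of two terms [f (z j) * e j x] with
    [0 <= e j x <= 1], so [|f|] is at most twice the supremum of the
    [|f (z j)|]; the factor [4] instead of [2] makes up for a supremum
    that is not attained. *)
Lemma large_node f : interpolation_space f -> exists n, `|f| / 4 <= `|f (z n)|.
Proof.
move=> Hf; apply/not_existsP => small.
have {}small n : `|f (z n)| < `|f| / 4 by rewrite ltNge; apply/negP/small.
have := small 0%N; rewrite ltNge => /negP; apply.
apply: le_trans (normr_ge0 _).
suff : `|f| <= `|f| / 2 by lra.
apply: cfun_norm_le => [|x]; first by rewrite divr_ge0.
rewrite Hf (le_trans (ler_normD _ _))// !normrM.
have le_node j : `|f (z j)| * `|e j x| <= `|f| / 4.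
  rewrite (le_trans _ (ltW (small j)))// ler_piMr//.
  by rewrite ger0_norm; case/andP: (e01 j x).
by have := le_node (p x); have := le_node (q x); lra.
Qed.

(** The point is [z n], unless [v] is small there. In that case it is [w n m],
    where the contribution [v (z m) / 8], of size at least [|v| / 32], dominates
    [v (z n)], and [u (z m) / 8], of size at most [|u| / 8], is too small to
    cancel [u (z n)]. *)
Lemma common_large_point_lt u v n m :
  interpolation_space u -> interpolation_space v -> (n < m)%N ->
  `|u| / 4 <= `|u (z n)| -> `|v| / 4 <= `|v (z m)| ->
  exists x, `|u| / 64 <= `|u x| /\ `|v| / 64 <= `|v x|.
Proof.
move=> Hu Hv nm un vm.
have u0 : 0 <= `|u| by []; have v0 : 0 <= `|v| by [].
have [vn|vn] := lerP (`|v| / 64) `|v (z n)|.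
  by exists (z n); split => //; lra.
exists (w n m); rewrite !interpolation_at_w//.
have um : `|u (z m)| <= `|u| := cfun_norm_ub u (z m).
have /= := lerB_normD (u (z n)) (u (z m) / 8).
have /= := lerB_normD (v (z m) / 8) (v (z n)).
rewrite [v (z m) / 8 + _]addrC !normrM [`|8^-1|]ger0_norm//.
by split; lra.
Qed.

Lemma common_large_point u v : interpolation_space u -> interpolation_space v ->
  exists x, `|u| / 64 <= `|u x| /\ `|v| / 64 <= `|v x|.
Proof.
move=> Hu Hv; have [n un] := large_node u Hu; have [m vm] := large_node v Hv.
have u0 : 0 <= `|u| by []; have v0 : 0 <= `|v| by [].
have [nm|mn|nm] := ltngtP n m.
- exact: common_large_point_lt nm un vm.
- have [x [vx ux]] := common_large_point_lt _ _ _ _ Hv Hu mn vm un.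
  by exists x.
- by exists (z n); rewrite {2}nm; split; lra.
Qed.

Lemma interpolation_space_spr : stable_phase_retrieval interpolation_space.
Proof.
apply/spr_min; first exact: interpolation_space_linear.
exists 64 => // u v m Hu Hv m0 uvm.
have [x [ux vx]] := common_large_point u v Hu Hv.
have := uvm x; rewrite !ge_min => /orP[h|h]; apply/orP; [left|right]; lra.
Qed.

End interpolation_space.

Theorem theorem6p1 (R : realType) (K : topologicalType)
    (cK : compact [set: K]) (hK : hausdorff_space K) :
  (exists E : set (cfun R cK),
      [/\ linear_subspace E, closed E, ~ finite_dimensional E
        & stable_phase_retrieval E])
  <-> infinite_set (cantor_bendixson_derivative K).
Proof.
split=> [[E [lE _ infE sprE]] finK|infK].
  exact: finite_derivative_no_spr finK lE infE sprE.
have [e [z [w [p [q [e_cts e01 ez ew pq]]]]]] := biorthogonal_bumps R K cK hK infK.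
exists (interpolation_space R K cK e z p q); split.
- exact: interpolation_space_linear.
- exact: interpolation_space_closed.
- exact: interpolation_space_infinite_dim ez pq.
- exact: interpolation_space_spr e01 ew pq.
Qed.
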